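(* Let $V$ be a Banach space, $W$ a normed linear space, $T : V \to W$ a bounded linear operator, and $(T_h)_{h \in (0,1)}$ a family of bounded linear operators $T_h : V \to W$. Suppose that $(T_h)$ is consistent with $T$. Then $(T_h)$ converges to $T$ if and only if $(T_h)$ is stable.
   Context: Definitions, for bounded linear operators $T, T_h : V \to W$ with parameter $h \in (0,1)$: - $(T_h)$ converges to $T$ (is convergent) if $\lim_{h \to 0} \Vert (T_h - T) v \Vert = 0$ for every $v \in V$. - $(T_h)$ is consistent with $T$ if there is a dense linear subspace $V_0$ of $V$ such that $\lim_{h \to 0} \Vert (T_h - T) v \Vert = 0$ for every $v \in V_0$. - $(T_h)$ is stable if $\sup_h \Vert T_h \Vert < \infty$ (operator norm). The upper limit of the range of $h$ is regarded as irrelevant, since only limits as $h \to 0$ are considered; thus stability means that there is $h_0 \in (0,1)$ such that $\sup_{0 < h < h_0} \Vert T_h \Vert < \infty$. *)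

(* Defs.v *)
From HB Require Import structures.
From mathcomp Require Import all_boot all_order all_algebra.
From mathcomp Require Import complex.
From mathcomp Require Import all_classical all_reals all_analysis.

Set Implicit Arguments.
Unset Strict Implicit.
Unset Printing Implicit Defensive.

Import Order.TTheory GRing.Theory Num.Theory.
Import numFieldNormedType.Exports.

Local Open Scope classical_set_scope.
Local Open Scope ring_scope.

(* Normed spaces are taken over the real or over the complex numbers;
   [scalars R s] is R or R[i] according to s. *)
Variant scalar_kind := RealScalars | ComplexScalars.

Definition scalars (R : realType) (s : scalar_kind) : numFieldType :=
  match s with
  | RealScalars => R
  | ComplexScalars => R[i]
  end.

Definition realpart (R : realType) (s : scalar_kind) : scalars R s -> R :=
  match s with
  | RealScalars => id
  | ComplexScalars => @complex.Re R
  end.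

(* The norm `|v| of MathComp-Analysis takes its values in the scalar field; it
   is a nonnegative real there, so that its real part is the norm as an element
   of R, where suprema are available. *)
Definition rnorm (R : realType) (s : scalar_kind)
    (V : normedModType (scalars R s)) (v : V) : R := realpart `|v|.

Section Operators.
Context (R : realType) (s : scalar_kind).
Context (V W : normedModType (scalars R s)).

Definition bounded_operator (f : {linear V -> W}) : Prop :=
  exists M : scalars R s, forall v : V, `|f v| <= M * `|v|.

Definition operator_norm (f : {linear V -> W}) : \bar R :=
  ereal_sup [set (rnorm (f v))%:E | v in [set v : V | `|v| <= 1]].

(* A family indexed by h in (0, 1) is a function of h : R whose values outside
   (0, 1) are never looked at: below, h tends to 0 from the right and is
   otherwise restricted to intervals (0, h0) with h0 < 1. *)

Definition convergent (T_ : R -> {linear V -> W}) (T : {linear V -> W}) : Prop :=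
  forall v : V, `|T_ h v - T v| @[h --> 0^'+] --> (0 : scalars R s).

Definition consistent (T_ : R -> {linear V -> W}) (T : {linear V -> W}) : Prop :=
  exists V0 : {pred V},
    [/\ submod_closed V0,
        dense [set` V0]
      & forall v : V, v \in V0 ->
          `|T_ h v - T v| @[h --> 0^'+] --> (0 : scalars R s)].

Definition stable (T_ : R -> {linear V -> W}) : Prop :=
  exists2 h0 : R, 0 < h0 < 1 &
    (ereal_sup [set operator_norm (T_ h) | h in [set h : R | (0 < h < h0)%R]]
       < +oo)%E.

End Operators.

(* Main.v *)
Require Import Defs.
From HB Require Import structures.
From mathcomp Require Import all_boot all_order all_algebra.
From mathcomp Require Import complex.
From mathcomp Require Import all_classical all_reals all_analysis.
Set Implicit Arguments.
Unset Strict Implicit.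
Import Order.TTheory GRing.Theory Num.Theory.
Import numFieldNormedType.Exports.
Local Open Scope classical_set_scope.
Local Open Scope ring_scope.

(** Stable and consistent implies convergent by a three-term estimate: for v in
    V and w in the dense subspace close to v, the difference T_h v - T v is
    T_h (v - w) - T (v - w) + (T_h w - T w), where the first two terms are small
    because T_h and T have a common bound for small h, and the last one is by
    consistency ([stable_convergent]).

    Convergent implies stable is the uniform boundedness principle, with one
    twist: convergence at v bounds T_h v only for h below a threshold that
    depends on v, so the family as a whole need not be pointwise bounded.  The
    principle is therefore proved for a decreasing sequence of sets of
    operators, the n-th one being here the T_h with 0 < h < 1/(n+2)
    ([uniform_boundedness]).  If no set of the sequence had a common operator
    bound, one could find, for every n and inside any ball, a smaller ball on
    which some operator of the n-th set only takes values of norm at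
    least n ([exists_ball_norm_ge]); iterating, nested balls of radii tending to
    0 meet at a point of the complete space V ([nested_closed_balls]), and the
    values at this point contradict the pointwise bound.

    This is a gliding hump argument that needs of the scalars only that their
    norms are archimedean, so that it covers the real and the complex case at
    once.  By the same archimedean property every bound can be replaced by a
    natural number, and natural numbers compare in the same way with a norm and
    with its real part; this connects operator bounds in the scalar field with
    suprema in the extended reals ([stableP]). *)

(** * Operator bounds *)

Definition operator_bound (K : numFieldType) (V W : normedModType K)
    (M : K) (f : V -> W) : Prop :=
  forall v, `|f v| <= M * `|v|.

(** A bound may be enlarged although nothing makes it nonnegative: when V is
    trivial, any scalar M is a bound, even a nonreal one, whence the norm of M
    in place of M. *)
Lemma operator_bound_le (K : numFieldType) (V W : normedModType K)
    (M M' : K) (f : V -> W) :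
  `|M| <= M' -> operator_bound M f -> operator_bound M' f.
Proof.
move=> MM' fM v; have Mv0 : 0 <= M * `|v| by rewrite (le_trans _ (fM v)).
rewrite (le_trans (fM v))// -(ger0_norm Mv0) normrM normr_id.
by rewrite ler_wpM2r.
Qed.

(** Unlike M, this bound is positive, so that radii can be defined by dividing
    by it. *)
Lemma operator_bound_add1_norm (K : numFieldType) (V W : normedModType K)
    (M : K) (f : V -> W) :
  operator_bound M f -> operator_bound (1 + `|M|) f.
Proof. by apply: operator_bound_le; rewrite lerDr ler01. Qed.

Lemma operator_bound_unit_ball (K : numFieldType) (V W : normedModType K)
    (M : K) (f : {linear V -> W}) :
  (forall v, `|v| <= 1 -> `|f v| <= M) -> operator_bound M f.
Proof.
move=> fM v; have [->|v0] := eqVneq v 0.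
  by rewrite linear0 !normr0 mulr0.
have nv0 : 0 < `|v| by rewrite normr_gt0.
have := fM (`|v|^-1 *: v).
rewrite linearZ !normrZ normfV normr_id mulVf ?gt_eqF// lexx => /(_ isT).
by rewrite ler_pdivrMl// mulrC.
Qed.

(** * The uniform boundedness principle *)

(** Cantor's intersection theorem for closed balls: the centres form a Cauchy
    sequence since the radii are at most r 0 / 2 ^ n, and each ball, being
    closed, contains the limit.  The last hypothesis expresses the nesting through
    centres and radii only, which makes it telescope. *)
Lemma nested_closed_balls (K : numFieldType) (V : completeNormedModType K)
    (x : nat -> V) (r : nat -> K) :
  Num.archimedean_axiom K -> (forall n, 0 < r n) ->
  (forall n, r n.+1 <= r n / 2) ->
  (forall n, `|x n.+1 - x n| + r n.+1 <= r n) ->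
  exists l, forall n, `|l - x n| <= r n.
Proof.
move=> archi r0 rhalf xr.
have dist_add n k : `|x (n + k)%N - x n| + r (n + k)%N <= r n.
  elim: k => [|k IHk]; first by rewrite addn0 subrr normr0 add0r.
  rewrite addnS; apply: le_trans IHk.
  rewrite (le_trans (lerD (ler_distD (x (n + k)%N) _ _) (lexx _)))//.
  by rewrite addrAC [leLHS]addrC lerD2l.
have dist_le n m : (n <= m)%N -> `|x m - x n| <= r n.
  move=> /subnKC <-; apply: le_trans (dist_add _ (m - n)%N).
  by rewrite lerDl ltW.
have rgeo n : r n <= r 0%N / n.+1%:R.
  have : r n <= r 0%N / 2 ^+ n.
    elim: n => [|n IHn]; first by rewrite expr0 divr1.
    rewrite (le_trans (rhalf n))// exprSr invfM mulrA.
    by rewrite ler_wpM2r// invr_ge0.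
  move=> /le_trans; apply; rewrite ler_wpM2l ?(ltW (r0 0%N))//.
  by rewrite lef_pV2 ?posrE ?exprn_gt0// -natrX ler_nat ltn_expl.
have : cvg (x @ \oo).
  apply: cauchy_cvg; apply: cauchy_exP => e e0.
  have [n rn] : exists n, r n < e.
    have [n] := archi (r 0%N / e).
    rewrite ger0_norm ?divr_ge0 ?(ltW e0) ?(ltW (r0 0%N))// => re.
    exists n; rewrite (le_lt_trans (rgeo n))// ltr_pdivrMr//.
    rewrite mulrC -ltr_pdivrMr// (lt_trans re)// ltr_nat//.
  exists (x n); exists n => // m /= nm.
  by rewrite -ball_normE /ball_/= distrC (le_lt_trans (dist_le _ _ nm)).
move=> /cvg_ex[/= l xl]; exists l => n.
apply/ler_addgt0Pr => e e0.
have /cvgrPdist_lt/(_ e e0) [m _ xm] := xl.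
have := xm (maxn n m) (leq_maxr _ _) => /= lx.
rewrite (le_trans (ler_distD (x (maxn n m)) _ _))// addrC.
by rewrite lerD ?dist_le ?leq_maxl// ltW.
Qed.

(** The step of the gliding hump.  Rescale u to xi of norm r / 2, so that
    f xi has norm at least N + 1.  As 2 f xi = f (x + xi) - f (x - xi), one of
    the points x + xi and x - xi has an image of norm at least N + 1, and the
    Lipschitz bound of f keeps the norm at least N on a small ball around it. *)
Lemma exists_ball_norm_ge (K : numFieldType) (V W : normedModType K)
    (M : K) (f : {linear V -> W}) (x u : V) (r N : K) :
  0 < M -> operator_bound M f -> 0 < r -> 0 <= N ->
  (N + 1) / (r / 2) * `|u| < `|f u| ->
  exists x' r', [/\ 0 < r', r' <= r / 2, `|x' - x| + r' <= r &
    forall y, `|y - x'| <= r' -> N <= `|f y|].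
Proof.
move=> M0 fM r0 N0 fu.
have r20 : 0 < r / 2 by rewrite divr_gt0.
have u0 : 0 < `|u|.
  rewrite normr_gt0; apply/eqP => u0.
  by move: fu; rewrite u0 linear0 !normr0 mulr0 ltxx.
pose xi := (r / 2 / `|u|) *: u.
have nxi : `|xi| = r / 2.
  by rewrite normrZ gtr0_norm ?divr_gt0// divfK ?gt_eqF.
have fxi : N + 1 <= `|f xi|.
  rewrite linearZ normrZ gtr0_norm ?divr_gt0//.
  rewrite mulrAC ler_pdivlMr// mulrC.
  by rewrite -(ler_pdivrMl _ _ r20) mulrCA [leLHS]mulrC [_ * (N + 1)]mulrC ltW.
have [x' [x'x fx']] : exists x', `|x' - x| = r / 2 /\ N + 1 <= `|f x'|.
  have sumle : `|f xi| *+ 2 <= `|f (x + xi)| + `|f (x - xi)|.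
    rewrite -normrMn (le_trans _ (ler_normB _ _))//.
    by rewrite -linearB opprB addrC addrA subrK -mulr2n linearMn.
  have [le|gt] := real_leP (normr_real (f (x - xi))) (normr_real (f (x + xi))).
    exists (x + xi); split; first by rewrite addrC addKr.
    rewrite (le_trans fxi)// -(ler_pMn2r (ltn0Sn 1)) (le_trans sumle)//.
    by rewrite mulr2n lerD2l.
  exists (x - xi); split; first by rewrite addrC addKr normrN.
  rewrite (le_trans fxi)// -(ler_pMn2r (ltn0Sn 1)) (le_trans sumle)//.
  by rewrite mulr2n lerD2r ltW.
(* The new radius 1 / (M + 2 / r) is at most both 1 / M, so that f varies by at
   most 1 on the new ball, and r / 2, so that this ball stays in the old one. *)
have d0 : 0 < M + (r / 2)^-1 by rewrite addr_gt0 ?invr_gt0.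
have r'r : (M + (r / 2)^-1)^-1 <= r / 2.
  by rewrite -[leRHS]invrK lef_pV2 ?posrE ?invr_gt0// lerDr ltW.
exists x', (M + (r / 2)^-1)^-1; split => //.
- by rewrite invr_gt0.
- by rewrite x'x [leRHS]splitr lerD2l.
- move=> y yx'.
  rewrite -(lerD2r 1) (le_trans fx')// -(subrK y x') linearD addrC.
  rewrite (le_trans (ler_normD _ _))// lerD2l (le_trans (fM _))//.
  rewrite distrC (@le_trans _ _ (M * (M + (r / 2)^-1)^-1)) ?ler_wpM2l ?(ltW M0)//.
  by rewrite ler_pdivrMr// mul1r lerDl ltW// invr_gt0.
Qed.

(** The uniform boundedness principle along a decreasing sequence of sets of
    operators: pointwise bounds may hold from a rank on that depends on the
    point, and the uniform bound then holds from some rank on.  For a constant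
    sequence this is the Banach-Steinhaus theorem. *)
Lemma uniform_boundedness (K : numFieldType) (V : completeNormedModType K)
    (W : normedModType K) (A : nat -> set {linear V -> W}) :
  Num.archimedean_axiom K ->
  (forall n m, (n <= m)%N -> A m `<=` A n) ->
  (forall n f, A n f -> exists M, operator_bound M f) ->
  (forall v, exists n M, forall f, A n f -> `|f v| <= M) ->
  exists n M, forall f, A n f -> operator_bound M f.
Proof.
move=> archi Adecr Abnd Apw; apply: contrapT => Aunb.
have large n M : M \is Num.real ->
    exists f, A n f /\ exists u, M * `|u| < `|f u|.
  move=> Mreal; apply: contrapT => nof; apply: Aunb; exists n, M => f Af v.
  rewrite real_leNgt ?realM ?normr_real//; apply/negP => fv.
  by apply: nof; exists f; split => //; exists v.
have step (s : nat * (V * {posnum K})) : exists t : V * {posnum K},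
    [/\ t.2%:num <= s.2.2%:num / 2,
        `|t.1 - s.2.1| + t.2%:num <= s.2.2%:num &
        exists2 f, A s.1 f &
          forall y, `|y - t.1| <= t.2%:num -> s.1%:R <= `|f y|].
  case: s => n [x r] /=; have r0 : 0 < r%:num by [].
  have [|f [Af [u fu]]] := large n ((n%:R + 1) / (r%:num / 2)).
    by rewrite ger0_real// divr_ge0// addr_ge0.
  have [M fM] := Abnd _ _ Af.
  have M'0 : 0 < 1 + `|M| by rewrite ltr_pwDl.
  have [x' [r' [r'0 r'r xr fy]]] :=
    exists_ball_norm_ge x M'0 (operator_bound_add1_norm fM) r0 (ler0n _ n) fu.
  by exists (x', PosNum r'0); split => //; exists f.
have [g gP] := choice step.
pose fix s (n : nat) : V * {posnum K} :=
  if n is p.+1 then g (p, s p) else (0, PosNum ltr01).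
have [|||l ls] := @nested_closed_balls K V (fun n => (s n).1)
    (fun n => (s n).2%:num) archi.
- by [].
- by move=> n; have [] := gP (n, s n).
- by move=> n; have [] := gP (n, s n).
have [n [M fM]] := Apw l.
(* At the rank max n k, the operator of the construction belongs to A n, where
   M bounds the values at l, and takes at l a value of norm at least k > M. *)
have [k Mk] := archi M.
have [_ _ [f Af fl]] := gP (maxn n k, s (maxn n k)).
have /fM flM := Adecr _ _ (leq_maxl n k) _ Af.
have /= mfl := fl l (ls (maxn n k).+1).
have Mreal : M \is Num.real by rewrite ger0_real// (le_trans _ flM).
have := le_lt_trans (real_ler_norm Mreal) Mk.
move=> /(le_lt_trans (le_trans mfl flM)); rewrite ltr_nat ltnNge.
by rewrite leq_maxr.
Qed.

(** * Stability through operator bounds *)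

Lemma scalars_archimedean (R : realType) (s : scalar_kind) :
  Num.archimedean_axiom (scalars R s).
Proof.
case: s => x /=.
  by exists (Num.truncn `|x|).+1; exact: truncnS_gt.
move: (normr_ge0 x); move: `|x| => y.
rewrite lecE => /andP[/eqP yI _]; exists (Num.truncn (complex.Re y)).+1.
rewrite -(rmorph_nat (real_complex R)) ltcE /= yI eqxx /=.
exact: truncnS_gt.
Qed.

(** A nonnegative complex number is real, which makes its real part faithful
    for comparisons with real scalars. *)
Lemma ler_realpart_nat (R : realType) (s : scalar_kind) (x : scalars R s) n :
  0 <= x -> (x <= n%:R) = (realpart x <= n%:R).
Proof.
case: s x => //= x x0.
have /eqP xI : complex.Im x == 0 by move: x0; rewrite lecE => /andP[].
by rewrite -(rmorph_nat (real_complex R)) lecE /= xI eqxx.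
Qed.

Lemma ler_operator_norm_nat (R : realType) (s : scalar_kind)
    (V W : normedModType (scalars R s)) (f : {linear V -> W}) n :
  (operator_norm f <= (n%:R)%:E)%E <-> operator_bound n%:R f.
Proof.
split=> [fn|fn].
  apply: operator_bound_unit_ball => v v1; rewrite ler_realpart_nat//.
  rewrite -lee_fin; apply: le_trans fn.
  by apply: ereal_sup_ubound; exists v.
apply: ge_ereal_sup => _ [v v1 <-]; rewrite lee_fin -ler_realpart_nat//.
by rewrite (le_trans (fn v))// -[leRHS]mulr1 ler_wpM2l.
Qed.

(** Stability without suprema: finite suprema in the extended reals give
    natural numbers as operator bounds, and conversely. *)
Lemma stableP (R : realType) (s : scalar_kind)
    (V W : normedModType (scalars R s)) (T_ : R -> {linear V -> W}) :
  stable T_ <-> exists2 h0 : R, 0 < h0 < 1 &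
    exists M, forall h, 0 < h < h0 -> operator_bound M (T_ h).
Proof.
split=> [] [h0 h01].
  move=> supoo; exists h0 => //.
  have [n supn] : exists n : nat,
      (ereal_sup [set operator_norm (T_ h) | h in [set h : R | (0 < h < h0)%R]]
        <= n%:R%:E)%E.
    move: supoo; case: ereal_sup => [r _|//|_]; last by exists 0%N; rewrite leNye.
    by exists (Num.truncn r).+1; rewrite lee_fin ltW// truncnS_gt.
  exists n%:R => h h0h; apply/ler_operator_norm_nat; apply: le_trans supn.
  by apply: ereal_sup_ubound; exists h.
move=> [M TM]; exists h0 => //; have [n Mn] := scalars_archimedean M.
apply: (@le_lt_trans _ _ n%:R%:E); last exact: ltry.
apply: ge_ereal_sup => _ [h h0h <-]; apply/ler_operator_norm_nat.
exact: operator_bound_le (ltW Mn) (TM h h0h).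
Qed.

(** * Consistency, stability and convergence *)

(** The uniform boundedness principle applied to the sets of the T_h with
    0 < h < 1/(n+2); this interval lies in (0, 1) and so does its upper end,
    as stability requires of h0. *)
Lemma convergent_stable (R : realType) (s : scalar_kind)
    (V : completeNormedModType (scalars R s)) (W : normedModType (scalars R s))
    (T : {linear V -> W}) (T_ : R -> {linear V -> W}) :
  (forall h : R, 0 < h < 1 -> bounded_operator (T_ h)) ->
  convergent T_ T -> stable T_.
Proof.
move=> Tbnd Tcvg; apply/stableP.
have inv1 n : n.+2%:R^-1 < 1 :> R by rewrite invf_lt1// ltr1n.
have [|||n [M TM]] :=
    @uniform_boundedness _ V W
      (fun n => T_ @` [set h | 0 < h < n.+2%:R^-1]) (@scalars_archimedean R s).
- move=> n m nm _ [h /= /andP[h0 hm] <-]; exists h => //=.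
  by rewrite h0 (lt_le_trans hm)// lef_pV2 ?posrE// ler_nat.
- move=> n _ [h /= /andP[h0 hn] <-]; apply: Tbnd.
  by rewrite h0 (lt_trans hn).
- move=> v; have /cvgr0Pnorm_lt/(_ 1 ltr01) := Tcvg v.
  move=> /nbhs_ballP[e /= e0 Te]; pose k := Num.truncn e^-1.
  have ke : k.+2%:R^-1 < e.
    rewrite -[ltRHS]invrK ltf_pV2 ?posrE ?invr_gt0//.
    by rewrite (lt_trans (truncnS_gt _))// ltr_nat.
  exists k, (1 + `|T v|) => _ [h /= /andP[h0 hk] <-].
  rewrite -[T_ h v](subrK (T v)) (le_trans (ler_normD _ _))// lerD2r.
  have := Te h; rewrite /= normr_id => Th; apply/ltW/Th => //.
  by rewrite -ball_normE/= sub0r normrN gtr0_norm// (lt_trans hk).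
- exists n.+2%:R^-1; first by rewrite invr_gt0 ltr0n inv1.
  by exists M => h hn; apply: TM; exists h.
Qed.

(** The three-term estimate; the distance d from v to w is chosen so that a
    common bound B of T_h - T turns it into e / 2. *)
Lemma stable_convergent (R : realType) (s : scalar_kind)
    (V W : normedModType (scalars R s))
    (T : {linear V -> W}) (T_ : R -> {linear V -> W}) :
  bounded_operator T -> consistent T_ T -> stable T_ -> convergent T_ T.
Proof.
move=> [C TC] [V0 [_ V0dense V0cvg]] /stableP[h0 /andP[h00 _] [M TM]] v.
pose B := (1 + `|M|) + `|C|.
have B0 : 0 < B by rewrite /B -addrA ltr_pwDl// addr_ge0.
apply/cvgr0Pnorm_lt => e e0.
pose d := e / 2 / B.
have d0 : 0 < d by rewrite !divr_gt0.
have [||w [vw V0w]] := V0dense (ball v d).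
- by exists v; exact: ballxx.
- exact: ball_open.
have wcvg : \forall h \near 0^'+, `|T_ h w - T w| < e / 2.
  have /cvgr0Pnorm_lt/(_ _ (divr_gt0 e0 (ltr0n _ 2))) := V0cvg w V0w.
  by under eq_near do rewrite normr_id.
near=> h; rewrite normr_id.
have vwd : `|v - w| < d by move: vw; rewrite -ball_normE.
have -> : T_ h v - T v = T_ h (v - w) - T (v - w) + (T_ h w - T w).
  rewrite (linearB (T_ h)) (linearB T) opprB addrACA subrK.
  by rewrite [T w - T v - T w]addrAC subrr add0r.
rewrite (le_lt_trans (ler_normD _ _))// [ltRHS]splitr ler_ltD//; last first.
  by near: h.
rewrite (le_trans (ler_normB _ _))//.
rewrite (@le_trans _ _ (B * `|v - w|))//; last first.
  by rewrite mulrC -ler_pdivlMr// ltW.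
have Thbound : operator_bound (1 + `|M|) (T_ h).
  apply/operator_bound_add1_norm/TM/andP; split; near: h.
    exact: nbhs_right_gt.
  exact: nbhs_right_lt.
by rewrite mulrDl lerD//; exact: operator_bound_le (lexx _) TC _.
Unshelve. all: by end_near. Qed.

Unset Implicit Arguments.

Theorem theorem3p3 (R : realType) (s : scalar_kind)
    (V : completeNormedModType (scalars R s)) (W : normedModType (scalars R s))
    (T : {linear V -> W}) (T_ : R -> {linear V -> W})
    (T_bounded : bounded_operator T)
    (Th_bounded : forall h : R, 0 < h < 1 -> bounded_operator (T_ h))
    (Th_consistent : consistent T_ T) :
  convergent T_ T <-> stable T_.
Proof.
split; first exact: convergent_stable.
exact: stable_convergent.
Qed.
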